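(* \[ C_U=\bigcap_{\mathbb{Q}\in\widehat{M}_V}\overline{K_U}^{L^1(\mathbb{Q})}=\bigcap_{\mathbb{Q}\in\widehat{M}_V}\overline{K-L^1_+(\mathbb{Q})}^{L^1(\mathbb{Q})}, \] where $\overline{A}^{L^1(\mathbb{Q})}$ denotes the closure of $A$ in the norm topology of $L^1(\mathbb{Q})$.
   Context: Let $(\Omega,\mathcal{F},\mathbb{P})$ be a probability space and $K\subseteq L^0(\mathbb{P})$ a convex cone (of terminal wealths). Let $a\in[-\infty,\infty)$ and $U:(a,\infty)\to\mathbb{R}$ be increasing, strictly concave, continuously differentiable with $\lim_{x\downarrow a}U'(x)=\infty$ and $\lim_{x\uparrow\infty}U'(x)=0$; if $a=-\infty$, assume moreover $\liminf_{x\to-\infty}\frac{xU'(x)}{U(x)}>1$. Let $V(y)=\sup_{x\in(a,\infty)}\{U(x)-xy\}$ for $y>0$ and $V^+=\max\{V,0\}$. Define $M_1=\{\mathbb{Q}\ll\mathbb{P}: X\in L^1(\mathbb{Q})\text{ and }\mathbb{E}_{\mathbb{Q}}[X]\le 0\text{ for all }X\in K\}$. A measure $\mathbb{Q}\ll\mathbb{P}$ has finite loss-entropy if there is $b>0$ with $\mathbb{E}_{\mathbb{P}}\big[V^+\big(\tfrac{d\mathbb{Q}}{d\mathbb{P}}\big)\mathbf{1}_{\{d\mathbb{Q}/d\mathbb{P}\ge b\}}\big]<\infty$; $\widehat{M}_V=\{\mathbb{Q}\in M_1:\mathbb{Q}\text{ has finite loss-entropy}\}$. Let $L_U=\bigcap_{\mathbb{Q}\in\widehat{M}_V}L^1(\mathbb{Q})$,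 let $L_V^+\subseteq L^1(\mathbb{P})$ be the linear span of the densities $d\mathbb{Q}/d\mathbb{P}$, $\mathbb{Q}\in\widehat{M}_V$, paired with $L_U$ via $\langle X,X^+\rangle=\mathbb{E}_{\mathbb{P}}[XX^+]$. Let $K_U=\{X\in L_U: X\le\widetilde X\text{ for some }\widetilde X\in K\}$ and $C_U$ the closure of $K_U$ in the weak topology $\sigma(L_U,L_V^+)$. Here $K-L^1_+(\mathbb{Q})=\{X-Y: X\in K,\ Y\in L^1_+(\mathbb{Q})\}$. *)

(* Defs.v *)
From HB Require Import structures.
From mathcomp Require Import all_boot all_order all_algebra.
From mathcomp Require Import all_classical all_reals all_analysis.
Set Implicit Arguments.
Unset Strict Implicit.
Unset Printing Implicit Defensive.
Import Order.TTheory GRing.Theory Num.Theory.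
Import numFieldNormedType.Exports.
Local Open Scope classical_set_scope.
Local Open Scope ring_scope.

Section Defs.
Context (R : realType).

Definition udom (a : \bar R) : set R := [set x | (a < x%:E)%E].

(** Standing assumptions on the utility function U : (a,oo) -> R
    (U is given as a total function R -> R; only its values on (a,oo) matter). *)
Definition utility_assumptions (a : \bar R) (U : R -> R) : Prop :=
  (a < +oo)%E /\
      (forall x y, udom a x -> udom a y -> x <= y -> U x <= U y) /\
      (forall x y t, udom a x -> udom a y -> x != y -> 0 < t -> t < 1 ->
         t * U x + (1 - t) * U y < U (t * x + (1 - t) * y)) /\
      (forall x, udom a x -> derivable U x 1 /\ {for x, continuous (derive1 U)}) /\
      (match a with
       | EFin a0 => (derive1 U) x @[x --> a0^'+] --> +oo
       | -oo%E => (derive1 U) x @[x --> -oo] --> +oo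
       | +oo%E => True
       end) /\
      ((derive1 U) x @[x --> +oo] --> 0) /\
      (* if a = -oo : liminf_{x -> -oo} x U'(x) / U(x) > 1 *)
      (a = -oo%E -> exists2 c : R, 1 < c &
         \forall x \near -oo, c < x * (derive1 U) x / U x).

Definition Vconj (a : \bar R) (U : R -> R) (y : R) : \bar R :=
  ereal_sup [set (U x - x * y)%:E | x in udom a].

Definition Vplus (a : \bar R) (U : R -> R) (y : R) : \bar R :=
  Order.max (Vconj a U y) 0%E.

Context d (Omega : measurableType d).

Definition L0 (X : Omega -> R) : Prop := measurable_fun setT X.

Definition L1 (Q : {measure set Omega -> \bar R}) (X : Omega -> R) : Prop :=
  measurable_fun setT X /\ Q.-integrable setT (EFin \o X).

Definition is_density (P Q : {measure set Omega -> \bar R}) (Z : Omega -> R) : Prop :=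
  [/\ measurable_fun setT Z, (forall w, 0 <= Z w) &
      forall A, measurable A -> Q A = (\int[P]_(w in A) (Z w)%:E)%E].

Definition convex_cone (K : set (Omega -> R)) : Prop :=
  (forall X, K X -> L0 X) /\
  (forall X Y (l m : R), K X -> K Y -> 0 <= l -> 0 <= m ->
     K (fun w => l * X w + m * Y w)).

Definition M1 (P : probability Omega R) (K : set (Omega -> R))
    (Q : probability Omega R) : Prop :=
  Q `<< P /\ forall X, K X -> L1 Q X /\ (\int[Q]_w (X w)%:E <= 0)%E.

Definition finite_loss_entropy (a : \bar R) (U : R -> R)
    (P Q : probability Omega R) : Prop :=
  exists Z, is_density P Q Z /\
    exists2 b : R, 0 < b &
      (\int[P]_w (if (b <= Z w)%R then Vplus a U (Z w) else 0%E) < +oo)%E.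

Definition MhatV a U P K (Q : probability Omega R) : Prop :=
  M1 P K Q /\ finite_loss_entropy a U P Q.

Definition LU a U P K (X : Omega -> R) : Prop :=
  L0 X /\ forall Q, MhatV a U P K Q -> L1 Q X.

Definition LVplus a U (P : probability Omega R) K (f : Omega -> R) : Prop :=
  exists (n : nat) (c : 'I_n -> R) (Q : 'I_n -> probability Omega R)
         (Z : 'I_n -> Omega -> R),
    (forall i, MhatV a U P K (Q i) /\ is_density P (Q i) (Z i)) /\
    f = (fun w => \sum_(i < n) c i * Z i w).

Definition pairing (P : probability Omega R) (X f : Omega -> R) : R :=
  fine (\int[P]_w (X w * f w)%:E).

Definition KU a U (P : probability Omega R) K (X : Omega -> R) : Prop :=
  LU a U P K X /\ exists2 Xt, K Xt & {ae P, forall w, X w <= Xt w}.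

(** Closure of A in the weak topology sigma(L_U, L_V^+): every basic
    neighbourhood {Y in L_U : |<Y - X, f_i>| < eps, i < n}, f_i in L_V^+,
    meets A. *)
Definition weak_closure a U (P : probability Omega R) K (A : set (Omega -> R))
    (X : Omega -> R) : Prop :=
  LU a U P K X /\
  forall (n : nat) (f : 'I_n -> Omega -> R) (eps : R),
    (forall i, LVplus a U P K (f i)) -> 0 < eps ->
    exists2 Y, A Y /\ LU a U P K Y &
      forall i, `|pairing P (fun w => Y w - X w) (f i)| < eps.

Definition CU a U P K : set (Omega -> R) := weak_closure a U P K (KU a U P K).

Definition L1_closure (Q : probability Omega R) (A : set (Omega -> R))
    (X : Omega -> R) : Prop :=
  L1 Q X /\ forall eps : R, 0 < eps ->
    exists2 Y, A Y /\ L1 Q Y &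
      (\int[Q]_w (`|X w - Y w|)%:E < eps%:E)%E.

Definition K_minus_L1plus (K : set (Omega -> R)) (Q : probability Omega R)
    : set (Omega -> R) :=
  [set Z | exists X Y, [/\ K X, L1 Q Y, {ae Q, forall w, 0 <= Y w} &
                         Z = (fun w => X w - Y w)]].

(** Intersection over Q in \hat M_V of a family of subsets of L^0(P)
    (an empty intersection is all of L^0(P)). *)
Definition bigcap_MhatV a U (P : probability Omega R) K
    (F : probability Omega R -> set (Omega -> R)) : set (Omega -> R) :=
  [set X | L0 X /\ forall Q, MhatV a U P K Q -> F Q X].

End Defs.

(* Main.v *)
Require Import Defs.
From HB Require Import structures.
From mathcomp Require Import all_boot all_order all_algebra.
From mathcomp Require Import all_classical all_reals all_analysis.
From mathcomp Require Import measurable_realfun.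
From mathcomp Require Import ring lra.
Import Order.TTheory GRing.Theory Num.Theory.
Import numFieldNormedType.Exports HBSimple.
Local Open Scope classical_set_scope.
Local Open Scope ring_scope.

Set Implicit Arguments.
Unset Strict Implicit.
Unset Printing Implicit Defensive.

(**
   Only the inclusion of the weak closure in each L1(Q)-closure is deep. If [X]
   is not in the L1(Q)-closure of [KU], the Hahn-Banach theorem gives an
   L1(Q)-continuous functional that is nonpositive on [KU] and positive at [X].
   As [KU] contains [- 1_A] for every event [A], the functional is positive, hence
   is integration against a finite measure bounded by a multiple of [Q]. Its
   normalisation [Q'] is again in [MhatV]: the growth of [U] near the left end of
   its domain yields [V^+(C y) <= A V^+(y) + B y] for large [y], so finite
   loss-entropy passes to densities bounded by [C dQ/dP]. Then [dQ'/dP] is a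
   weakly continuous functional separating [X] from [KU].

   Conversely, two measures of [MhatV] are both bounded by twice their midpoint,
   which is in [MhatV] because [V] is quasiconvex. So the finitely many
   functionals of a basic weak neighbourhood are all bounded by one L1(Q)-norm.

   Finally [X - Y] with [Y >= 0] in L1(Q) is approximated by the elements
   [X - min(Y^+, n)] of [KU].
*)

(** * Hahn-Banach theorem on a subspace *)

Section HahnBanach.
Context (R : realType) (V : lmodType R).

(** Everything is relative to a subspace because L1(Q) appears below as a set of plain functions,
    not quotiented by almost sure equality. *)
Definition linear_subspace (D : set V) : Prop :=
  D 0 /\ forall (t : R) x y, D x -> D y -> D (t *: x + y).

Definition sublinear_on (D : set V) (p : V -> R) : Prop :=
  (forall x y, D x -> D y -> p (x + y) <= p x + p y) /\
  (forall t x, D x -> 0 <= t -> p (t *: x) = t * p x).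

Definition linear_on (D : set V) (l : V -> R) : Prop :=
  forall t x y, D x -> D y -> l (t *: x + y) = t * l x + l y.

Context (D : set V) (sD : linear_subspace D).

Lemma subspaceD x y : D x -> D y -> D (x + y).
Proof. by move=> Dx Dy; rewrite -[x]scale1r; exact: sD.2. Qed.

Lemma subspaceZ t x : D x -> D (t *: x).
Proof. by move=> Dx; rewrite -[_ *: _]addr0; apply: sD.2 => //; exact: sD.1. Qed.

Lemma subspaceN x : D x -> D (- x).
Proof. by rewrite -scaleN1r; exact: subspaceZ. Qed.

Lemma sublinear0 p : sublinear_on D p -> p 0 = 0.
Proof. by case=> _ /(_ 0 0 sD.1 (lexx _)); rewrite scale0r mul0r. Qed.

Lemma sublinear_lb p x : sublinear_on D p -> D x -> - p (- x) <= p x.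
Proof.
move=> sp Dx; rewrite -subr_ge0 opprK -(sublinear0 sp) -(subrr x).
by apply: sp.1 => //; exact: subspaceN.
Qed.

Lemma sublinear_onP p : p 0 = 0 ->
  (forall x y, D x -> D y -> p (x + y) <= p x + p y) ->
  (forall t x, D x -> 0 < t -> p (t *: x) <= t * p x) -> sublinear_on D p.
Proof.
move=> p0 pD pZ; split => // t x Dx; rewrite le_eqVlt => /predU1P[<-|t0].
  by rewrite scale0r mul0r.
apply/eqP; rewrite eq_le pZ//= -ler_pdivlMl//.
rewrite -{1}[x](scalerK (lt0r_neq0 t0)).
by apply: pZ; rewrite ?invr_gt0//; exact: subspaceZ.
Qed.

(** The witness is [q x = inf_{t >= 0} (p (x + t x0) - t p x0)]. A minimal [p] must equal its own
    [q], and the last bound then gives [p (- x0) <= - p x0]. *)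
Lemma sublinear_slide p x0 : sublinear_on D p -> D x0 ->
  exists q, [/\ sublinear_on D q, (forall x, D x -> q x <= p x) &
    q (- x0) <= - p x0].
Proof.
move=> sp Dx0.
pose S x := [set p (x + t *: x0) - t * p x0 | t in [set t : R | 0 <= t]].
have Slb x : D x -> lbound (S x) (- p (- x)).
  move=> Dx _ [t /= t0 <-]; rewrite lerBrDr -sp.2// addrC lerBlDr.
  rewrite -{1}[t *: x0](addrK x) [t *: x0 + x]addrC.
  apply: sp.1; last exact: subspaceN.
  by apply: subspaceD => //; exact: subspaceZ.
have S0 x : S x !=set0 by exists (p (x + 0 *: x0) - 0 * p x0); exists 0 => /=.
have Sinf x : D x -> has_inf (S x).
  by move=> Dx; split => //; exists (- p (- x)); exact: Slb.
have infle x t : D x -> 0 <= t -> inf (S x) <= p (x + t *: x0) - t * p x0.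
  by move=> Dx t0; apply: ge_inf; [exact: (Sinf x Dx).2|exists t].
have infleP x : D x -> inf (S x) <= p x.
  by move=> Dx; have := infle x 0 Dx (lexx _); rewrite scale0r mul0r addr0 subr0.
exists (fun x => inf (S x)); split.
- apply: sublinear_onP.
  + apply/eqP; rewrite eq_le; apply/andP; split.
      by rewrite -(sublinear0 sp); exact/infleP/sD.1.
    apply: lb_le_inf => // _ [t t0 <-].
    by rewrite add0r sp.2// subrr.
  + move=> x y Dx Dy; rewrite -lerBlDl.
    apply: lb_le_inf => // _ [s /= s0 <-].
    rewrite lerBlDl -lerBlDr; apply: lb_le_inf => // _ [t /= t0 <-].
    rewrite lerBlDr.
    apply: (le_trans (infle _ (t + s) (subspaceD Dx Dy) (addr_ge0 t0 s0))).
    have : p (x + y + (t + s) *: x0) <= p (x + t *: x0) + p (y + s *: x0).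
      rewrite scalerDl addrACA; apply: sp.1; apply: subspaceD => //;
        exact: subspaceZ.
    by lra.
  + move=> t x Dx t0; rewrite -ler_pdivrMl//.
    apply: lb_le_inf => // _ [s /= s0 <-]; rewrite ler_pdivrMl// mulrBr -sp.2.
    * rewrite scalerDr scalerA mulrA; apply: infle; first exact: subspaceZ.
      by rewrite mulr_ge0// ltW.
    * by apply: subspaceD => //; exact: subspaceZ.
    * exact: ltW.
- exact: infleP.
- have := infle (- x0) 1 (subspaceN Dx0) ler01.
  by rewrite scale1r addNr (sublinear0 sp) mul1r sub0r.
Qed.

(** Zorn's lemma: the pointwise infimum of a chain is again subadditive, since of two members of the
    chain one lies below both. *)
Lemma minimal_sublinear p : sublinear_on D p ->
  exists q, [/\ sublinear_on D q, (forall x, D x -> q x <= p x) &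
    forall r, sublinear_on D r -> (forall x, D x -> r x <= q x) ->
      forall x, D x -> r x = q x].
Proof.
move=> sp.
pose T := {q : V -> R | sublinear_on D q /\ forall x, D x -> q x <= p x}.
pose t0 : T := exist _ p (conj sp (fun x _ => lexx _)).
(* The order is reversed, so that a maximal element is a minimal functional. *)
pose le (q r : T) := `[< forall x, D x -> sval r x <= sval q x >].
have sT (q : T) : sublinear_on D (sval q) by case: q => ? [].
have pT (q : T) x : D x -> sval q x <= p x by case: q => ? [] /= _; exact.
have [||A totA|q qmax] := @ZL_preorder T t0 le.
- by move=> t; apply/asboolP.
- move=> r s t /asboolP rs /asboolP st; apply/asboolP => x Dx.
  by rewrite (le_trans (st _ Dx))// rs.
- have [[a0 Aa0]|A0] := pselect (A !=set0); last first.
    by exists t0 => s As; exfalso; apply: A0; exists s.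
  pose S x := [set sval a x | a in A].
  have S0 x : S x !=set0 by exists (sval a0 x); exists a0.
  have Slb x : D x -> lbound (S x) (- p (- x)).
    move=> Dx _ [a Aa <-]; rewrite (le_trans _ (sublinear_lb (sT a) Dx))//.
    by rewrite lerN2; apply/pT/subspaceN.
  have Sinf x a : D x -> A a -> inf (S x) <= sval a x.
    by move=> Dx Aa; apply: ge_inf; [exists (- p (- x)); exact: Slb|exists a].
  have sm : sublinear_on D (fun x => inf (S x)).
    apply: sublinear_onP.
    + have -> : S 0 = [set 0].
        apply/seteqP; split=> [_ [a Aa <-]|_ ->]; first exact: sublinear0.
        by exists a0 => //; exact: sublinear0.
      by rewrite inf1.
    + move=> x y Dx Dy; rewrite -lerBlDl.
      apply: lb_le_inf => // _ [b Ab <-].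
      rewrite lerBlDl -lerBlDr; apply: lb_le_inf => // _ [a Aa <-].
      rewrite lerBlDr.
      have [c [Ac ca cb]] : exists c, [/\ A c, (forall x, D x -> sval c x <= sval a x) &
          (forall x, D x -> sval c x <= sval b x)].
        by have [/asboolP ab|/asboolP ba] := totA _ _ Aa Ab; [exists b|exists a].
      rewrite (le_trans (Sinf _ _ (subspaceD Dx Dy) Ac))//.
      by rewrite (le_trans ((sT c).1 _ _ Dx Dy))// lerD ?ca ?cb.
    + move=> t x Dx t_gt0; rewrite -ler_pdivrMl//.
      apply: lb_le_inf => // _ [a Aa <-]; rewrite ler_pdivrMl//.
      rewrite -(sT a).2 ?(ltW t_gt0)//.
      by apply: Sinf => //; exact: subspaceZ.
  have mp x : D x -> inf (S x) <= p x.
    by move=> Dx; rewrite (le_trans (Sinf _ _ Dx Aa0))// pT.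
  pose m : T := exist _ (fun x => inf (S x)) (conj sm mp).
  exists m => s As; apply/asboolP => x Dx /=.
  exact: Sinf.
- exists (sval q); split => //; first exact: pT.
  move=> r sr rq x Dx.
  have rp y : D y -> r y <= p y by move=> Dy; rewrite (le_trans (rq _ Dy))// pT.
  pose r' : T := exist _ r (conj sr rp).
  have /asboolP /(_ x Dx) /= qr := qmax r' (asboolT rq).
  by apply/eqP; rewrite eq_le rq.
Qed.

(** A minimal sublinear functional is linear, because sliding it in any direction changes nothing.
    Sliding [p] along [x0] before minimising forces [l x0 = p x0]. *)
Lemma Hahn_Banach p x0 : sublinear_on D p -> D x0 ->
  exists l, [/\ linear_on D l, (forall x, D x -> l x <= p x) & l x0 = p x0].
Proof.
move=> sp Dx0; have [p' [sp' p'p p'x0]] := sublinear_slide sp Dx0.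
have [l [sl lp' lmin]] := minimal_sublinear sp'.
have lN x : D x -> l (- x) = - l x.
  move=> Dx; have [q [sq ql qx]] := sublinear_slide sl Dx.
  apply/eqP; rewrite eq_le -(lmin _ sq ql (- x)) ?qx/=; last exact: subspaceN.
  rewrite (lmin _ sq ql); last exact: subspaceN.
  by rewrite lerNl; apply: sublinear_lb.
have lZ t x : D x -> l (t *: x) = t * l x.
  move=> Dx; have [t0|/ltW t0] := leP 0 t; first exact: sl.2.
  rewrite -[t]opprK scaleNr lN; last exact: subspaceZ.
  by rewrite sl.2 ?oppr_ge0// !mulNr opprK.
have lD x y : D x -> D y -> l (x + y) = l x + l y.
  move=> Dx Dy; apply/eqP; rewrite eq_le sl.1//=.
  rewrite -lerN2 opprD -!lN//; last exact: subspaceD.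
  by rewrite opprD; apply: sl.1; exact: subspaceN.
exists l; split.
- by move=> t x y Dx Dy; rewrite lD ?lZ//; exact: subspaceZ.
- by move=> x Dx; rewrite (le_trans (lp' _ Dx))// p'p.
- apply/eqP; rewrite eq_le (le_trans (lp' _ Dx0) (p'p _ Dx0))/=.
  by rewrite -lerN2 -lN// (le_trans (lp' _ (subspaceN Dx0))).
Qed.

End HahnBanach.

(** * The L1 seminorm and domination between measures *)

Section L1_space.
Context (R : realType) d (Omega : measurableType d).
Implicit Types (mu nu : {measure set Omega -> \bar R}) (X Y : Omega -> R).

Definition L1norm mu X : R := \int[mu]_w `|X w|.

Lemma L1_abs mu X : L1 mu X -> L1 mu (fun w => `|X w|).
Proof.
move=> [mX iX]; split; first exact: measurableT_comp.
exact: (integrable_norm iX).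
Qed.

Lemma L1_linear_subspace mu : linear_subspace (L1 mu : set (Omega -> R)).
Proof.
split; first by split; [exact: measurable_cst|exact: integrable0].
move=> t X Y [mX iX] [mY iY]; split.
  apply: measurable_funD => //; exact: measurable_funM.
have := integrableD measurableT (integrableZl measurableT t iX) iY.
by apply: eq_integrable.
Qed.

Lemma L1D mu X Y : L1 mu X -> L1 mu Y -> L1 mu (fun w => X w + Y w).
Proof. by move=> ? ?; apply: (subspaceD (L1_linear_subspace mu)). Qed.

Lemma L1Z mu t X : L1 mu X -> L1 mu (fun w => t * X w).
Proof. by move=> ?; apply: (subspaceZ (L1_linear_subspace mu)). Qed.

Lemma L1B mu X Y : L1 mu X -> L1 mu Y -> L1 mu (fun w => X w - Y w).
Proof.
move=> ? LY; apply: L1D => //.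
by apply: (subspaceN (L1_linear_subspace mu)).
Qed.

Lemma L1normE mu X : L1 mu X ->
  (\int[mu]_w (`|X w|)%:E)%E = (L1norm mu X)%:E.
Proof.
by move=> /L1_abs[mX iX]; rewrite /L1norm/Rintegral fineK//; exact: integrable_fin_num.
Qed.

Lemma L1norm_ge0 mu X : 0 <= L1norm mu X.
Proof. by apply: Rintegral_ge0. Qed.

Lemma L1norm0 mu : L1norm mu 0 = 0.
Proof. by rewrite /L1norm; under eq_Rintegral do rewrite normr0; rewrite Rintegral_cst// mul0r. Qed.

Lemma L1normN mu X : L1norm mu (- X) = L1norm mu X.
Proof. by rewrite /L1norm; under eq_Rintegral do rewrite normrN. Qed.

Lemma ler_L1normD mu X Y : L1 mu X -> L1 mu Y ->
  L1norm mu (X + Y) <= L1norm mu X + L1norm mu Y.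
Proof.
move=> LX LY; rewrite /L1norm -RintegralD//; try exact: (L1_abs _).2.
apply: le_Rintegral => //; try exact: (L1_abs (L1D _ _)).2.
- exact: (L1D (L1_abs LX) (L1_abs LY)).2.
- by move=> w _; exact: ler_normD.
Qed.

Lemma L1normZ mu t X : L1 mu X -> L1norm mu (t *: X) = `|t| * L1norm mu X.
Proof.
move=> LX; rewrite /L1norm -RintegralZl//; last exact: (L1_abs LX).2.
by apply: eq_Rintegral => w _; rewrite -normrM.
Qed.

Lemma normr_Rintegral_L1norm mu X : L1 mu X ->
  `|\int[mu]_w X w| <= L1norm mu X.
Proof. by move=> [mX iX]; exact: le_normr_Rintegral. Qed.

Lemma Rintegral_linear mu :
  linear_on (L1 mu : set (Omega -> R)) (fun X => \int[mu]_w X w).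
Proof.
move=> t X Y LX LY; rewrite -RintegralZl//; last exact: LX.2.
by rewrite -RintegralD//; [exact: (L1Z t LX).2|exact: LY.2].
Qed.

(** The density bound [d nu / d mu <= M], expressed on sets so that no density has to be chosen. *)
Definition measure_le_scale (M : R) nu mu :=
  forall A, measurable A -> (nu A <= M%:E * mu A)%E.

Lemma measure_le_scale_ge0_integral M nu mu (f : Omega -> \bar R) : 0 <= M ->
  measure_le_scale M nu mu -> (forall w, 0 <= f w)%E -> measurable_fun setT f ->
  (\int[nu]_w f w <= M%:E * \int[mu]_w f w)%E.
Proof.
move=> M0 numu f0 mf.
rewrite -(_ : (NngNum M0)%:num = M)// -ge0_integral_mscale//.
by apply: ge0_le_measure_integral.
Qed.

Lemma measure_le_scale_L1 M nu mu X : 0 <= M -> measure_le_scale M nu mu ->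
  L1 mu X -> L1 nu X.
Proof.
move=> M0 numu LX; split; first exact: LX.1.
apply/integrableP; split; first exact/measurable_EFinP/LX.1.
apply: (@le_lt_trans _ _ (M%:E * \int[mu]_w (`|X w|)%:E)%E).
  apply: measure_le_scale_ge0_integral => //.
  by apply/measurable_EFinP/measurableT_comp => //; exact: LX.1.
by rewrite L1normE// -EFinM ltry.
Qed.

Lemma measure_le_scale_L1norm M nu mu X : 0 <= M -> measure_le_scale M nu mu ->
  L1 mu X -> L1norm nu X <= M * L1norm mu X.
Proof.
move=> M0 numu LX; have LnuX := measure_le_scale_L1 M0 numu LX.
rewrite -lee_fin EFinM -(L1normE LX) -(L1normE LnuX).
apply: measure_le_scale_ge0_integral => //.
by apply/measurable_EFinP/measurableT_comp => //; exact: LX.1.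
Qed.

Lemma L1_bounded (Q : probability Omega R) X (M : R) : measurable_fun setT X ->
  (forall w, `|X w| <= M) -> L1 Q X.
Proof.
move=> mX XM; split => //; apply: measurable_bounded_integrable => //.
  by apply: (le_lt_trans (probability_le1 Q measurableT)); rewrite ltry.
by exists M; split; [exact: num_real|] => x Mx w _ /=; rewrite (le_trans (XM w))// ltW.
Qed.

Lemma L1_indic (Q : probability Omega R) A : measurable A -> L1 Q \1_A.
Proof.
move=> mA; split; first exact: measurable_indic.
exact: integrable_indic.
Qed.

Lemma L1norm_indic (Q : probability Omega R) A : measurable A ->
  ((L1norm Q \1_A)%:E = Q A)%E.
Proof.
move=> mA; rewrite -L1normE; last exact: L1_indic.
under eq_integral do rewrite ger0_norm//.
by rewrite integral_indic// setIT.
Qed.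

Lemma L1_sfun_dense (Q : probability Omega R) X (eps : R) : L1 Q X -> 0 < eps ->
  exists2 s : {sfun Omega >-> R}, L1 Q s & L1norm Q (X - s) <= eps.
Proof.
move=> LX eps0.
have [g_ [ig _ /fine_cvgP[fing gcvg]]] :=
  approximation_sfun_integrable measurableT LX.2.
have /cvgrPdist_le /(_ _ eps0) := gcvg.
move=> [n _ /(_ n (leqnn n))] /=; rewrite sub0r normrN => le_eps.
exists (g_ n); first by split; [exact: measurable_funPT|exact: ig].
by rewrite (le_trans _ le_eps)// /L1norm /Rintegral ler_norm.
Qed.

End L1_space.

(** * Separation in L1(Q) by a probability measure *)

Section L1_separation.
Context (R : realType) d (Omega : measurableType d) (Q : probability Omega R).

(** Hahn-Banach is applied at [X] to the L1 distance to [C], which is sublinear because [C] is a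
    convex cone. This distance is at most the norm, vanishes on [C], and is positive at a point
    outside the closure. *)
Lemma L1_separation (C : set (Omega -> R)) (X : Omega -> R) :
  C `<=` L1 Q -> C 0 -> (forall Y Y', C Y -> C Y' -> C (Y + Y')) ->
  (forall t Y, 0 <= t -> C Y -> C (t *: Y)) ->
  L1 Q X -> ~ L1_closure Q C X ->
  exists l, [/\ linear_on (L1 Q : set (Omega -> R)) l,
    (forall Z, L1 Q Z -> `|l Z| <= L1norm Q Z),
    (forall Y, C Y -> l Y <= 0) & 0 < l X].
Proof.
move=> CL C0 CD CZ LX nX.
pose N := L1norm Q.
have sL := @L1_linear_subspace R d Omega Q.
have LB Z Y : L1 Q Z -> C Y -> L1 Q (Z - Y) by move=> LZ /CL LY; exact: L1B.
pose S Z := [set N (Z - Y) | Y in C].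
have S0 Z : S Z !=set0 by exists (N (Z - 0)); exists 0.
have Slb Z : lbound (S Z) 0 by move=> _ [Y _ <-]; exact: L1norm_ge0.
have infle Z Y : C Y -> inf (S Z) <= N (Z - Y).
  by move=> CY; apply: ge_inf; [exists 0|exists Y].
have sp : sublinear_on (L1 Q : set (Omega -> R)) (fun Z => inf (S Z)).
  apply: sublinear_onP => //.
  - apply/eqP; rewrite eq_le lb_le_inf// andbT.
    by rewrite (le_trans (infle _ _ C0))// subr0 /N L1norm0.
  - move=> Z Z' LZ LZ'; rewrite -lerBlDl.
    apply: lb_le_inf => // _ [Y' CY' <-].
    rewrite lerBlDl -lerBlDr; apply: lb_le_inf => // _ [Y CY <-].
    rewrite lerBlDr (le_trans (infle _ _ (CD _ _ CY CY')))//.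
    by rewrite opprD addrACA; apply: ler_L1normD; exact: LB.
  - move=> t Z LZ t0; rewrite -ler_pdivrMl//.
    apply: lb_le_inf => // _ [Y CY <-]; rewrite ler_pdivrMl//.
    rewrite -[X in X * _]ger0_norm ?(ltW t0)// -L1normZ; last exact: LB.
    by rewrite scalerBr; apply/infle/CZ => //; exact: ltW.
have [l [ll lp lX]] := Hahn_Banach sL sp LX.
have lN Z : L1 Q Z -> l (- Z) = - l Z.
  move=> LZ; have l0 : l 0 = 0.
    by have := ll 1 0 0 sL.1 sL.1; rewrite scaler0 addr0 mul1r; lra.
  have := ll (-1) Z 0 LZ sL.1; rewrite addr0 scaleN1r => ->; lra.
have lN1 Z : L1 Q Z -> l Z <= N Z.
  by move=> LZ; rewrite (le_trans (lp _ LZ))// (le_trans (infle _ _ C0))// subr0.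
exists l; split => //.
- move=> Z LZ; rewrite ler_norml lN1// andbT lerNl -lN//.
  by rewrite (le_trans (lN1 _ (subspaceN sL LZ)))// /N L1normN.
- move=> Y CY; rewrite (le_trans (lp _ (CL _ CY)))//.
  by rewrite (le_trans (infle _ _ CY))// subrr /N L1norm0.
- rewrite lX; apply: contra_notT nX; rewrite -leNgt => infX; split => // eps eps0.
  have SX : has_inf (S X) by split => //; exists 0.
  have [_ [Y CY <-] XY] := inf_adherent eps0 SX.
  exists Y; first by split => //; exact: CL.
  by rewrite (L1normE (LB _ _ LX CY)) lte_fin (lt_le_trans XY)// gerDr.
Qed.

Lemma L1_linear_sum (l : (Omega -> R) -> R) (I : Type) (s : seq I)
    (a : I -> R) (Z : I -> Omega -> R) :
  linear_on (L1 Q : set (Omega -> R)) l -> (forall i, L1 Q (Z i)) ->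
  L1 Q (\sum_(i <- s) a i *: Z i) /\
  l (\sum_(i <- s) a i *: Z i) = \sum_(i <- s) a i * l (Z i).
Proof.
move=> ll LZ; have sL := @L1_linear_subspace R d Omega Q.
elim: s => [|i s [IH1 IH2]].
  rewrite !big_nil; split; first exact: sL.1.
  by have := ll 1 0 0 sL.1 sL.1; rewrite scaler0 addr0 mul1r; lra.
by rewrite !big_cons ll// IH2; split => //; exact: sL.2.
Qed.

(* A positive functional that is continuous for the L1 norm is countably
   additive on indicators because its tails are dominated by those of [Q]. *)
Lemma L1_positive_functional (M : R) (l : (Omega -> R) -> R) : 0 <= M ->
  linear_on (L1 Q : set (Omega -> R)) l ->
  (forall Z, L1 Q Z -> `|l Z| <= M * L1norm Q Z) ->
  (forall A, measurable A -> 0 <= l \1_A) ->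
  exists nu : {measure set Omega -> \bar R},
    [/\ (forall A, measurable A -> nu A = (l \1_A)%:E),
        measure_le_scale M nu Q &
        forall Z, L1 Q Z -> l Z = \int[nu]_w Z w].
Proof.
move=> M0 ll lM l_ge0; have sL := @L1_linear_subspace R d Omega Q.
have lD X Y : L1 Q X -> L1 Q Y -> l (X + Y) = l X + l Y.
  by move=> LX LY; rewrite -[X]scale1r ll// mul1r scale1r.
have l0 : l 0 = 0 by have := lD 0 0 sL.1 sL.1; rewrite addr0; lra.
have lZ t X : L1 Q X -> l (t *: X) = t * l X.
  by move=> LX; have := ll t X 0 LX sL.1; rewrite l0 !addr0.
have lB X Y : L1 Q X -> L1 Q Y -> l (X - Y) = l X - l Y.
  move=> LX LY; have LN := subspaceN sL LY.
  by rewrite lD// -[in LHS]scaleN1r lZ// mulN1r.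
(* A measure must be nonnegative on all sets, while [l] is known to be so only on indicators of
   measurable ones; hence the maximum with 0. *)
pose m (A : set Omega) : \bar R := (Num.max (l \1_A) 0)%:E.
have mE A : measurable A -> m A = (l \1_A)%:E.
  by move=> mA; rewrite /m; congr EFin; apply/max_idPl/l_ge0.
have m0 : m set0 = 0%E by rewrite /m indic0 (_ : cst 0 = 0)// l0 maxxx.
have m_ge0 A : (0 <= m A)%E by rewrite lee_fin le_max lexx orbT.
have mM A : measurable A -> (m A <= M%:E * Q A)%E.
  move=> mA; rewrite mE// -L1norm_indic// -EFinM lee_fin.
  by rewrite (le_trans (ler_norm _))// lM//; exact: L1_indic.
have indicUd A B : A `&` B = set0 -> \1_(A `|` B) = \1_A + \1_B :> (Omega -> R).
  move=> AB0; apply/funext => w; rewrite fctE !indicE in_setU.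
  have [wA|] := boolP (w \in A); last by rewrite add0r.
  have [wB|] := boolP (w \in B); last by rewrite addr0.
  have : (A `&` B) w by split; exact: set_mem.
  by rewrite AB0.
have mU A B : measurable A -> measurable B -> A `&` B = set0 ->
    m (A `|` B) = (m A + m B)%E.
  move=> mA mB AB0; rewrite !mE//; last exact: measurableU.
  by rewrite indicUd// lD//; exact: L1_indic.
have madd : measure_function.additive m.
  by rewrite -semi_additiveE; apply/(additive2P m0).
have msa : semi_sigma_additive m.
  move=> F mF tF mUF; set W := \bigcup_n F n.
  pose B n := \big[setU/set0]_(i < n) F i.
  have mB n : measurable (B n) by exact: bigsetU_measurable.
  have BW n : B n `<=` W by move=> w; rewrite /B -bigcup_mkord => -[k _ Fk]; exists k.
  have QB : fine (Q (B n)) @[n --> \oo] --> fine (Q W).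
    apply/fine_cvg; rewrite fineK ?fin_num_measure//.
    rewrite (_ : (fun n => Q (B n)) = (fun n => (\sum_(0 <= i < n) Q (F i))%E)).
      exact: measure_semi_sigma_additive.
    by apply/funext => n; rewrite measure_bigsetU// big_mkord.
  have lW n : l \1_W = l \1_(B n) + l \1_(W `\` B n).
    apply: EFin_inj; rewrite EFinD -!mE//; last exact: measurableD.
    rewrite -mU ?setDUK//; first exact: measurableD.
    exact: setDIK.
  have lWB n : l \1_(W `\` B n) <= M * (fine (Q W) - fine (Q (B n))).
    rewrite -lee_fin -mE; last exact: measurableD.
    apply: (le_trans (mM _ _)); first exact: measurableD.
    rewrite measureD//; last by rewrite ltey_eq fin_num_measure.
    by rewrite setIidr// EFinM EFinB !fineK ?fin_num_measure.
  rewrite (_ : (fun n => (\sum_(0 <= i < n) m (F i))%E) = (fun n => (l \1_(B n))%:E)).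
    rewrite mE//; apply/cvg_EFin; first by apply: nearW.
    apply: (@squeeze_cvgr _ _ _ _
      (fun n => l \1_W - M * (fine (Q W) - fine (Q (B n)))) (fun=> l \1_W)).
    - apply: nearW => n /=; have := lWB n; have := lW n.
      have : 0 <= l \1_(W `\` B n) by exact/l_ge0/measurableD.
      by lra.
    - rewrite -[X in _ --> X]subr0 -(mulr0 M) -(subrr (fine (Q W))).
      by apply: cvgB; [exact: cvg_cst|apply: cvgMl_tmp; apply: cvgB => //; exact: cvg_cst].
    - exact: cvg_cst.
  by apply/funext => n; rewrite -mE// madd// big_mkord.
pose nu : {measure set Omega -> \bar R} :=
  HB.pack m (isMeasure.Build _ _ _ m m0 m_ge0 msa).
have numu : measure_le_scale M nu Q by [].
exists nu; split => //.
have LQnu Z : L1 Q Z -> L1 nu Z := measure_le_scale_L1 M0 numu.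
pose I (Z : Omega -> R) := \int[nu]_w Z w.
have lI : linear_on (L1 Q : set (Omega -> R)) I.
  by move=> t X Y /LQnu LX /LQnu LY; exact: Rintegral_linear.
have lIindic A : measurable A -> I \1_A = l \1_A.
  by move=> mA; rewrite /I/Rintegral integral_indic// setIT -[nu A]/(m A) mE.
have lIsfun (s : {sfun Omega >-> R}) : I s = l s.
  have [r sE] : exists r : seq R,
      (s : Omega -> R) = \sum_(y <- r) y *: \1_(s @^-1` [set y]).
    exists (finmap.enum_fset (fset_set (range s))).
    by apply/funext => w; rewrite fimfunE fsbig_finite//= fct_sumE.
  have ms y : measurable (s @^-1` [set y]) by exact: measurable_sfunP.
  rewrite sE (L1_linear_sum r id lI (fun y => L1_indic Q (ms y))).2.
  rewrite (L1_linear_sum r id ll (fun y => L1_indic Q (ms y))).2.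
  by apply: eq_bigr => y _; rewrite lIindic.
move=> Z LZ; apply/eqP; rewrite -subr_eq0 -normr_le0; apply/ler_addgt0Pl => e e0.
rewrite addr0.
(* [l] and [I] each contribute at most [M] times the norm of [Z - s]; the extra 1 keeps the divisor
   positive. *)
have M2 : 0 < M + M + 1 by lra.
have [s Ls Zs] := L1_sfun_dense LZ (divr_gt0 e0 M2).
have LZs : L1 Q (Z - s) := L1B LZ Ls.
have -> : l Z - I Z = l (Z - s) - I (Z - s).
  rewrite lB//; have := lI (-1) s Z Ls LZ; rewrite scaleN1r addrC => ->.
  by rewrite lIsfun; lra.
rewrite (le_trans (ler_normB _ _))//.
have := lM _ LZs; have := normr_Rintegral_L1norm (LQnu _ LZs).
have := measure_le_scale_L1norm M0 numu LZs; rewrite -/(I _).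
have := L1norm_ge0 Q (Z - s).
move: Zs; rewrite ler_pdivlMr//.
move: (L1norm _ _) (L1norm _ _) `|_| `|_| => a b c f.
by nra.
Qed.

Lemma separating_probability (C : set (Omega -> R)) (X : Omega -> R) :
  C `<=` L1 Q -> C 0 -> (forall Y Y', C Y -> C Y' -> C (Y + Y')) ->
  (forall t Y, 0 <= t -> C Y -> C (t *: Y)) ->
  (forall A, measurable A -> C (- \1_A)) ->
  L1 Q X -> ~ L1_closure Q C X ->
  exists (Q' : probability Omega R) (M : R),
    [/\ 0 <= M, measure_le_scale M Q' Q,
        (forall Y, C Y -> \int[Q']_w Y w <= 0) & 0 < \int[Q']_w X w].
Proof.
move=> CL C0 CD CZ CA LX nX.
have [l [ll lN lC lX]] := L1_separation CL C0 CD CZ LX nX.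
have l_ge0 A : measurable A -> 0 <= l \1_A.
  move=> mA; have := lC _ (CA _ mA); rewrite -scaleN1r.
  have := L1_linear_sum [:: tt] (fun=> -1) ll (fun=> L1_indic Q mA).
  by rewrite !big_seq1 => -[_ ->]; lra.
(* If [l] vanished at the constant 1, its representing measure would be null and [l X] would be
   0. *)
have c0 : 0 < l (\1_setT).
  have [|nu [nuE _ lnu]] := @L1_positive_functional 1 l ler01 ll _ l_ge0.
    by move=> Z LZ; rewrite mul1r lN.
  rewrite lt_neqAle l_ge0// andbT eq_sym; apply: contraTN lX => /eqP c0.
  rewrite lnu// /Rintegral null_set_integral//=; first by rewrite ltxx.
    exact/measurable_EFinP/LX.1.
  by rewrite nuE// c0.
set c := l _ in c0; have cV0 : 0 <= c^-1 by rewrite invr_ge0 ltW.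
have [|||nu [nuE nuQ lnu]] :=
    @L1_positive_functional c^-1 (fun Z => c^-1 * l Z) cV0.
- by move=> t Y Z LY LZ; rewrite ll// mulrDr mulrCA.
- by move=> Z LZ; rewrite normrM ger0_norm// ler_wpM2l// lN.
- by move=> A mA; rewrite mulr_ge0// l_ge0.
have nu1 : nu setT = 1%E by rewrite nuE// mulVf// gt_eqF.
(* [nu] already has mass 1, so normalising leaves its values unchanged; [Q] is only the fallback for
   degenerate mass. *)
pose Q' : probability Omega R := mnormalize nu Q.
have Q'E A : Q' A = nu A by rewrite /Q'/= /mnormalize nu1 onee_eq0/= invr1 mule1.
have lQ' Z : L1 Q Z -> \int[Q']_w Z w = c^-1 * l Z.
  move=> LZ; rewrite lnu//; congr fine.
  by apply: eq_measure_integral => A _ _; exact: Q'E.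
exists Q', c^-1; split => //.
- by move=> A mA; have := nuQ A mA; rewrite -Q'E.
- by move=> Y CY; rewrite lQ'; [rewrite pmulr_rle0 ?invr_gt0// lC|exact: CL].
- by rewrite lQ'// mulr_gt0// invr_gt0.
Qed.

End L1_separation.

(** * The conjugate [V]: quasiconvexity, finiteness and growth *)

Section conjugate.
Context (R : realType) (a : \bar R) (U : R -> R).

Lemma le_Vconj x y : udom a x -> ((U x - x * y)%:E <= Vconj a U y)%E.
Proof. by move=> ax; apply: ereal_sup_ubound; exists x. Qed.

(** For fixed [x] the map [y -> U x - x y] is monotone, and the sign of [x] tells which endpoint
    dominates. *)
Lemma Vconj_le_max b y c : b <= y -> y <= c ->
  (Vconj a U y <= Order.max (Vconj a U b) (Vconj a U c))%E.
Proof.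
move=> by_ yc; apply: ge_ereal_sup => _ [x ax <-]; rewrite le_max.
have [x0|x0] := leP 0 x.
  rewrite (le_trans _ (le_Vconj b ax))// lee_fin; nra.
by rewrite orbC (le_trans _ (le_Vconj c ax))// lee_fin; nra.
Qed.

Lemma Vplus_ge0 y : (0 <= Vplus a U y)%E.
Proof. by rewrite le_max lexx orbT. Qed.

(** A sum rather than a maximum, as these bounds are later integrated term by term. *)
Lemma Vplus_leD b y c : b <= y -> y <= c ->
  (Vplus a U y <= Vplus a U b + Vplus a U c)%E.
Proof.
move=> by_ yc; rewrite ge_max adde_ge0 ?Vplus_ge0// andbT.
rewrite (le_trans (Vconj_le_max by_ yc))// ge_max.
apply/andP; split.
  by apply: (@le_trans _ _ (Vplus a U b)); rewrite ?le_max ?lexx// leeDl ?Vplus_ge0.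
by apply: (@le_trans _ _ (Vplus a U c)); rewrite ?le_max ?lexx// leeDr ?Vplus_ge0.
Qed.

(* Sublevel sets of a quasiconvex function are intervals. *)
Lemma measurable_Vplus : measurable_fun setT (Vplus a U).
Proof.
apply: measurable_maxe; last exact: measurable_cst.
apply: (measurability _ (ErealGenOInfty.measurableE R)) => _ [_ [r ->] <-].
rewrite setTI preimage_itvoy -[X in measurable X]setCK; apply: measurableC.
apply: is_interval_measurable => b c /= Vb Vc y /andP[by_ yc].
move/negP: Vb; move/negP: Vc; rewrite -!leNgt => Vc Vb.
apply/negP; rewrite -leNgt.
by rewrite (le_trans (Vconj_le_max by_ yc))// ge_max Vb.
Qed.

Hypothesis uU : utility_assumptions a U.

Lemma udom_ltW x y : udom a x -> x <= y -> udom a y.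
Proof. by rewrite /udom/= => ax xy; rewrite (lt_le_trans ax)// lee_fin. Qed.

(** If [U x] exceeded the tangent value, concavity would keep the difference quotients from [x0]
    towards [x] away from the derivative by a fixed gap. *)
Lemma utility_tangent x0 x : udom a x0 -> udom a x ->
  U x <= U x0 + derive1 U x0 * (x - x0).
Proof.
move=> ax0 ax; have [_ [_ [sc [/(_ _ ax0)[dU _] _]]]] := uU.
have [->|xx0] := eqVneq x x0; first by rewrite subrr mulr0 addr0.
set D := derive1 U x0; set h := x - x0.
have h0 : h != 0 by rewrite subr_eq0.
rewrite leNgt; apply/negP => gap.
(* Multiplied by [|h|] this tolerance is half the gap, whereas concavity makes [q * h] exceed
   [D * h] by more than the whole gap. *)
have e0 : 0 < (U x - U x0 - D * h) / (2 * `|h|).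
  by rewrite divr_gt0 ?mulr_gt0 ?normr_gt0//; lra.
have : s^-1 *: (U (s *: 1 + x0) - U x0) @[s --> 0^'] --> D.
  by rewrite /D derive1E; exact: dU.
move=> /cvgrPdist_lt /(_ _ e0) /nbhs_ballP[r /= r0 near0].
(* The first bound gives [t < 1] for concavity, the second puts the step [t * h] within distance
   [r]. *)
pose t := Num.min (2^-1) (r / (2 * `|h|)).
have nh0 : 0 < `|h| by rewrite normr_gt0.
have t0 : 0 < t by rewrite lt_min divr_gt0 ?mulr_gt0// invr_gt0 ltr0n.
have t1 : t < 1 by rewrite gt_min; apply/orP; left; lra.
have tr : t * `|h| < r.
  apply: (@le_lt_trans _ _ (r / (2 * `|h|) * `|h|)).
    by rewrite ler_pM2r// ge_min lexx orbT.
  rewrite invfM mulrA -mulrA mulVf ?gt_eqF// mulr1; lra.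
have th0 : t * h != 0 by rewrite mulf_neq0// gt_eqF.
have := near0 (t * h); rewrite /ball/= sub0r normrN normrM (ger0_norm (ltW t0)).
move=> /(_ tr th0); rewrite /= [_ *: 1]mulr1.
have -> : t * h + x0 = t * x + (1 - t) * x0 by rewrite /h; ring.
have := sc _ _ _ ax ax0 xx0 t0 t1.
set W := U (_ + _) => Wgt; rewrite [_ *: _]mulrC.
set q := (W - U x0) / (t * h) => qD.
have Wq : W = U x0 + q * (t * h) by rewrite /q mulfVK//; ring.
have {}Wgt : U x - U x0 < q * h.
  rewrite -(ltr_pM2l t0); move: Wgt; rewrite Wq; lra.
have : `|D - q| * `|h| < (U x - U x0 - D * h) / 2.
  rewrite -ltr_pdivlMr// -mulrA -invfM//.
rewrite -normrM ltr_norml => /andP[+ _]; rewrite mulrBl.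
by lra.
Qed.

(** Intermediate value theorem: [U'] is continuous and tends to infinity at the left end of the
    domain. The bound [x <= x1] later places the point where the elasticity bound is valid. *)
Lemma derive1_surj x1 y : udom a x1 -> derive1 U x1 <= y ->
  exists2 x, udom a x & x <= x1 /\ derive1 U x = y.
Proof.
move=> ax1 Ux1; have [a_lt [_ [_ [dU [lima _]]]]] := uU.
have [x2 [ax2 x21 Ux2]] : exists x2, [/\ udom a x2, x2 <= x1 & y <= derive1 U x2].
  move: ax1 lima {dU a_lt}; move: a => [a0| |]; rewrite /udom/= => ax1 lima //.
  - have /cvgryPge /(_ y) Uy := lima.
    have near1 := @nbhs_right_gt R a0.
    have near2 : \forall x \near a0^'+, x < x1 by apply: nbhs_right_lt; rewrite -lte_fin.
    have [x [[/= ? ?] ?]] := filter_ex (filterI (filterI near1 near2) Uy).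
    by exists x; split => //; exact: ltW.
  - have /cvgryPge /(_ y) Uy := lima.
    have [x [/= ? ?]] := filter_ex (filterI (nbhs_ninfty_le (num_real x1)) Uy).
    by exists x; split => //; rewrite ltNyr.
have [|||x] := @IVT R (derive1 U) x2 x1 y => //.
- apply: continuous_in_subspaceT => x; rewrite inE/= in_itv/= => /andP[x2x _].
  exact: (dU x (udom_ltW ax2 x2x)).2.
- by rewrite ge_min le_max Ux1 Ux2 orbT.
rewrite in_itv/= => /andP[x2x xx1] Uxy; exists x => //.
exact: udom_ltW x2x.
Qed.

(** By the tangent inequality the supremum is attained at [x]. *)
Lemma VconjE x : udom a x ->
  Vconj a U (derive1 U x) = (U x - x * derive1 U x)%:E.
Proof.
move=> ax; apply/eqP; rewrite eq_le le_Vconj// andbT.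
apply: ge_ereal_sup => _ [z az <-]; rewrite lee_fin.
by have := utility_tangent ax az; lra.
Qed.

Lemma exists_udom : exists x, udom a x.
Proof.
have [a_lt _] := uU; rewrite /udom; move: a a_lt => [a0| |]//= _.
  by exists (a0 + 1); rewrite lte_fin ltrDl.
by exists 0; rewrite ltNyr.
Qed.

(** The two limits of [U'] make every [y > 0] a slope [U' x], and there the supremum is attained. *)
Lemma Vconj_lty y : 0 < y -> (Vconj a U y < +oo)%E.
Proof.
move=> y0; have [_ [_ [_ [_ [_ [lim0 _]]]]]] := uU.
have [x ax] := exists_udom.
have /cvgrPdist_le /(_ _ y0) Uy := lim0.
have [x1 [/= xx1 +]] := filter_ex (filterI (nbhs_pinfty_ge (num_real x)) Uy).
rewrite sub0r normrN => /(le_trans (ler_norm _)) Ux1.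
have [x2 ax2 [_ <-]] := derive1_surj (udom_ltW ax xx1) Ux1.
by rewrite VconjE// ltry.
Qed.

Lemma Vplus_fin_num y : 0 < y -> Vplus a U y \is a fin_num.
Proof.
by move=> y0; rewrite ge0_fin_numE ?Vplus_ge0// gt_max Vconj_lty//= ltry.
Qed.

(** Write [U x - x y = (U x - x) - x (y - 1)]: the first term is at most [V^+(1)], and [- x <= |a0|]
    on the domain. *)
Lemma Vplus_linear_growth a0 : a = a0%:E ->
  exists2 B, 0 <= B & forall y, 1 <= y -> (Vplus a U y <= (B * y)%:E)%E.
Proof.
move=> aE; set v := fine (Vplus a U 1).
have vE : Vplus a U 1 = v%:E by rewrite fineK// Vplus_fin_num.
have v0 : 0 <= v by rewrite -lee_fin -vE Vplus_ge0.
exists (v + `|a0|) => [|y y1]; first by rewrite addr_ge0.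
rewrite ge_max lee_fin mulr_ge0 ?addr_ge0//; last lra.
rewrite andbT; apply: ge_ereal_sup => _ [x ax <-]; rewrite lee_fin.
have Uv : U x - x * 1 <= v by rewrite -lee_fin -vE le_max le_Vconj.
have a0x : a0 < x by move: ax; rewrite /udom/= aE lte_fin.
have xa0 : 0 <= x + `|a0| by have := ler_norm (- a0); rewrite normrN; lra.
have y10 : 0 <= y - 1 by lra.
by have := mulr_ge0 xa0 y10; have := mulr_ge0 v0 y10; have := normr_ge0 a0; lra.
Qed.

(* The elasticity bound [x U'(x) <= c U(x)] near [-oo] makes one geometric step
   of ratio [2c/(c+1)] at most double [V]. *)
Lemma Vplus_doubling : a = -oo%E ->
  exists2 lam : R, 1 < lam & exists2 y0 : R, 0 < y0 &
    forall y : R, y0 <= y -> (Vplus a U (lam * y) <= 2%:E * Vplus a U y)%E.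
Proof.
move=> aE; have [_ [_ [_ [_ [lima [_ /(_ aE)[c c1 el]]]]]]] := uU.
have aT x : udom a x by rewrite aE /udom/= ltNyr.
move: lima; rewrite aE => /cvgryPge /(_ 1) U1; rewrite -aE.
have := filterI (filterI U1 el) (nbhs_ninfty_lt (num_real 0)).
move=> [m [_ near_m]].
have {}near_m (x : R) : x <= m - 1 -> 0 < derive1 U x /\ x * derive1 U x <= c * U x.
  move=> xm; have /near_m[[/= U'1 cU x0]] : x < m by lra.
  split; first by lra.
  (* Only [U x < 0] is possible: the quotient is negative when [U x > 0], and 0 by convention when
     [U x = 0], so it could not exceed [c > 1]. *)
  have [U0|U0|U0] := ltgtP (U x) 0.
  - by move: cU; rewrite ltr_ndivlMr// => /ltW.
  - by move: cU; rewrite ltr_pdivlMr// => cU; nra.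
  - by move: cU; rewrite U0 invr0 mulr0; lra.
(* With [z = lam * y] this ratio gives [(c + 1) x z = 2 c x y], so that [x z <= c U x] implies
   [U x - x z <= 2 (U x - x y)]. *)
pose lam := 2 * c / (c + 1).
have lam1 : 1 < lam by rewrite ltr_pdivlMr; lra.
(* Above this threshold [lam * y] is the slope of [U] at some [x <= m - 1], where the elasticity
   bound holds. *)
exists lam => //; exists (Num.max 1 (derive1 U (m - 1))).
  by rewrite lt_max ltr01.
move=> y; rewrite ge_max => /andP[y1 my].
have ylam : y <= lam * y by rewrite ler_peMl//; [lra|exact: ltW].
have [x ax [xm U'x]] := derive1_surj (aT (m - 1)) (le_trans my ylam).
have [U'0 cU] := near_m x xm.
rewrite ge_max; apply/andP; split; last by rewrite mule_ge0 ?Vplus_ge0.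
rewrite -U'x VconjE// U'x.
apply: (@le_trans _ _ (2%:E * (U x - x * y)%:E)%E); last first.
  by rewrite lee_pmul2l// le_max le_Vconj.
rewrite -EFinM lee_fin; move: cU; rewrite U'x.
have zE : x * (lam * y) * (c + 1) = 2 * c * x * y.
  have c10 : c + 1 != 0 by rewrite gt_eqF//; lra.
  by rewrite /lam; field.
move: (lam * y) zE => z zE cU; have c0 : 0 < c by lra.
by rewrite -(ler_pM2l c0); lra.
Qed.

(** For finite [a] linear growth suffices, with [A = 0]. For [a = -oo] doubling is iterated until
    [lam ^+ n >= C]; quasiconvexity bounds the value at [C y] by those at [y] and [lam ^+ n * y],
    whence [A = 1 + 2 ^+ n]. *)
Lemma Vplus_scale (C : R) : 1 <= C ->
  exists A B y0 : R, [/\ 0 <= A, 0 <= B, 0 < y0 &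
    forall y, y0 <= y -> (Vplus a U (C * y) <= A%:E * Vplus a U y + (B * y)%:E)%E].
Proof.
move=> C1; have [a_lt _] := uU.
case aE : a a_lt => [a0| |]// _; rewrite -aE.
  have [B B0 VB] := Vplus_linear_growth aE.
  exists 0, (B * C), 1; split => //; first by rewrite mulr_ge0//; lra.
  move=> y y1; rewrite mul0e add0e -mulrA; apply: VB.
  by rewrite -[1]mulr1 ler_pM.
have [lam lam1 [y0 y00 Vlam]] := Vplus_doubling aE.
have iterV n y : y0 <= y ->
    (Vplus a U (lam ^+ n * y) <= (2 ^+ n)%:E * Vplus a U y)%E.
  move=> y0y; elim: n => [|n IH]; first by rewrite !expr0 mul1r mul1e.
  rewrite exprS -mulrA (le_trans (Vlam _ _))//.
    rewrite (le_trans y0y)// ler_peMl ?exprn_ege1 ?(ltW lam1)//; lra.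
  by rewrite exprS EFinM -muleA lee_pmul2l.
have [n Cn] : exists n, C <= lam ^+ n.
  have lamV : `|lam^-1| < 1 by rewrite ger0_norm ?invr_ge0 ?invf_lt1; lra.
  have CV : 0 < C^-1 by rewrite invr_gt0; lra.
  have /cvgrPdist_le /(_ _ CV) := cvg_expr lamV.
  move=> [n _ /(_ n (leqnn n))] /=; rewrite sub0r normrN exprVn.
  rewrite ger0_norm ?invr_ge0 ?exprn_ge0//; last lra.
  by rewrite lef_pV2 ?posrE ?exprn_gt0//; [exists n|lra..].
exists (1 + 2 ^+ n), 0, y0; split => //.
move=> y y0y; rewrite mul0r adde0.
have y_ge0 : 0 <= y by lra.
apply: (@le_trans _ _ (Vplus a U y + Vplus a U (lam ^+ n * y))%E).
  by apply: Vplus_leD; [rewrite ler_peMl|rewrite ler_wpM2r].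
by rewrite EFinD ge0_muleDl ?lee_fin ?exprn_ge0// mul1e leeD2l// iterV.
Qed.

End conjugate.

(** * Measures dominated up to a constant, and midpoints *)

Section dominated.
Context (R : realType) d (Omega : measurableType d).
Implicit Types (mu nu la : {measure set Omega -> \bar R}) (M N : R).

Lemma measure_le_scale_null M mu nu : measure_le_scale M mu nu -> mu `<< nu.
Proof.
move=> dM; apply/null_content_dominatesP => A mA nuA.
by apply/eqP; rewrite eq_le measure_ge0 andbT (le_trans (dM _ mA))// nuA mule0.
Qed.

Lemma measure_le_scale_le M N mu nu : M <= N -> measure_le_scale M mu nu ->
  measure_le_scale N mu nu.
Proof.
move=> MN dM A mA; rewrite (le_trans (dM _ mA))//.
by rewrite lee_wpmul2r// lee_fin.
Qed.

Lemma measure_le_scale_trans M N mu nu la : 0 <= M ->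
  measure_le_scale M mu nu -> measure_le_scale N nu la -> measure_le_scale (M * N) mu la.
Proof.
move=> M0 d12 d23 A mA; rewrite (le_trans (d12 _ mA))//.
by rewrite EFinM -muleA lee_wpmul2l ?lee_fin// d23.
Qed.

Lemma Rintegral_mscale (k : {nonneg R}) mu X : L1 mu X ->
  \int[mscale k mu]_w X w = k%:num * \int[mu]_w X w.
Proof.
move=> [mX iX]; have mX' : measurable_fun setT (EFin \o X) by exact/measurable_EFinP.
rewrite /Rintegral integralE [in RHS]integralE.
rewrite !ge0_integral_mscale//; [|exact: measurable_funeneg|exact: measurable_funepos].
have ip := integrable_pos_fin_num measurableT iX.
have in_ := integrable_neg_fin_num measurableT iX.
by rewrite -muleBr ?fin_num_adde_defr// fineM// fin_numB ip in_.
Qed.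

(** The integral formula is what carries the constraints [E[X] <= 0] over to the midpoint. *)
Lemma exists_midpoint (Q1 Q2 : probability Omega R) :
  exists Q : probability Omega R,
    (forall A, measurable A -> Q A = (2^-1%:E * (Q1 A + Q2 A))%E) /\
    forall X, L1 Q1 X -> L1 Q2 X -> L1 Q X /\
      \int[Q]_w X w = 2^-1 * (\int[Q1]_w X w + \int[Q2]_w X w).
Proof.
pose half : {nonneg R} := NngNum (ltW (divr_gt0 ltr01 (ltr0Sn R 1))).
have halfE : half%:num = 2^-1 by rewrite /half/= mul1r.
pose s : {measure set Omega -> \bar R} := measure_add Q1 Q2.
pose mu : {measure set Omega -> \bar R} := mscale half s.
have muE A : mu A = (2^-1%:E * (Q1 A + Q2 A))%E.
  by rewrite /mu/= /mscale halfE /s -measure_addE.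
have mu1 : mu setT = 1%E.
  by rewrite muE !probability_setT -EFinD -EFinM mulVf.
pose Q : probability Omega R := mnormalize mu Q1.
have QE A : Q A = mu A by rewrite /Q/= /mnormalize mu1 onee_eq0/= invr1 mule1.
exists Q; split => [A mA|X LX1 LX2]; first by rewrite QE muE.
have eqQ (f : Omega -> \bar R) : (\int[Q]_w f w = \int[mu]_w f w)%E.
  by apply: eq_measure_integral => A _ _; exact: QE.
have mX : measurable_fun setT X := LX1.1.
have mnX : measurable_fun setT (fun w => `|X w|%:E).
  by apply/measurable_EFinP; exact: measurableT_comp.
have iX : (\int[s]_w `|X w|%:E < +oo)%E.
  by rewrite ge0_integral_measure_add// !L1normE// -EFinD ltry.
have LsX : L1 s X.
  by split => //; apply/integrableP; split => //; exact/measurable_EFinP.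
split.
  split => //; apply/integrableP; split; first exact/measurable_EFinP.
  rewrite eqQ ge0_integral_mscale//=.
  by rewrite (L1normE LsX) -EFinM ltry.
rewrite {1}/Rintegral eqQ -/(Rintegral mu setT X) Rintegral_mscale// halfE.
congr (_ * _); rewrite /Rintegral integral_measure_add//.
- by rewrite fineD//; apply: integrable_fin_num => //; [exact: LX1.2|exact: LX2.2].
- exact: LX1.2.
- exact: LX2.2.
Qed.

End dominated.

(** * Densities with respect to [P] *)

Section density.
Context (R : realType) d (Omega : measurableType d) (P : probability Omega R).
Implicit Types (Q : probability Omega R) (Z X : Omega -> R).

Lemma is_density_null Q Z : is_density P Q Z -> Q `<< P.
Proof.
move=> [mZ Z0 QZ]; apply/null_content_dominatesP => A mA PA.
rewrite QZ// null_set_integral//.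
exact/measurable_funTS/measurable_EFinP.
Qed.

Lemma is_density_L1 Q Z : is_density P Q Z -> L1 P Z.
Proof.
move=> [mZ Z0 QZ]; split => //; apply/integrableP; split.
  exact/measurable_EFinP.
under eq_integral do rewrite /= ger0_norm//.
by rewrite -QZ//; apply: (le_lt_trans (probability_le1 Q measurableT)); rewrite ltry.
Qed.

Lemma exists_density Q : Q `<< P -> exists Z, is_density P Q Z.
Proof.
move=> QP; pose f := Radon_Nikodym_SigmaFinite.f Q P.
have fE w : (fine (f w))%:E = f w.
  by rewrite fineK//; exact: Radon_Nikodym_SigmaFinite.f_fin_num.
exists (fine \o f); split.
- apply/measurable_EFinP; rewrite (_ : EFin \o _ = f); last exact/funext.
  exact: measurable_int (Radon_Nikodym_SigmaFinite.f_integrable _).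
- by move=> w; rewrite fine_ge0// Radon_Nikodym_SigmaFinite.f_ge0.
- move=> A mA; under eq_integral do rewrite fE.
  exact: Radon_Nikodym_SigmaFinite.f_integral.
Qed.

(** [Z] agrees almost everywhere with the Radon-Nikodym derivative, whose change of variables
    formula applies; used for [|X|], it also gives integrability. *)
Lemma is_density_change Q Z X : is_density P Q Z -> L1 Q X ->
  L1 P (fun w => X w * Z w) /\ \int[P]_w (X w * Z w) = \int[Q]_w X w.
Proof.
move=> dZ LX; have QP := is_density_null dZ.
have LZ := is_density_L1 dZ; case: dZ => mZ Z0 QZ.
pose g := Radon_Nikodym (charge_of_finite_measure Q) P.
have ig : P.-integrable setT g by exact: Radon_Nikodym_integrable.
have gZ : ae_eq P setT g (EFin \o Z).
  apply: integral_ae_eq => //; first exact/measurable_EFinP.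
  by move=> A _ mA; rewrite -Radon_Nikodym_integral//= QZ.
have key Y : L1 Q Y ->
    (\int[P]_w (Y w * Z w)%:E = \int[Q]_w (Y w)%:E)%E.
  move=> [mY iY]; rewrite -(Radon_Nikodym_change_of_variables QP measurableT iY).
  apply: ae_eq_integral => //.
  - by apply/measurable_EFinP; exact: measurable_funM.
  - apply: emeasurable_funM; first exact/measurable_EFinP.
    exact: measurable_int ig.
  - by move: gZ; apply: filterS => w gZw _; have := gZw I; rewrite /g EFinM /= => ->.
split; last by rewrite /Rintegral key.
have mXZ : measurable_fun setT (fun w => X w * Z w).
  by apply: measurable_funM => //; exact: LX.1.
split => //; apply/integrableP; split; first exact/measurable_EFinP.
under eq_integral => w _.
  rewrite /= normrM (ger0_norm (Z0 w)); over.
by rewrite (key _ (L1_abs LX)) L1normE// ltry.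
Qed.

(** On [A = {Z' > M Z}] the integral of [Z' - M Z] is [Q' A - M Q A <= 0], and a positive integrand
    then forces [A] to be null. *)
Lemma density_le_ae Q Q' Z Z' M : is_density P Q Z -> is_density P Q' Z' ->
  measure_le_scale M Q' Q -> {ae P, forall w, Z' w <= M * Z w}.
Proof.
move=> dZ dZ' Q'Q.
have LZ := is_density_L1 dZ; have LZ' := is_density_L1 dZ'.
pose D w := Z' w - M * Z w.
have LD : L1 P D by exact: L1B LZ' (L1Z M LZ).
pose A := [set w | 0 < D w].
have mA : measurable A.
  rewrite -[A]setTI; apply: measurable_fun_ltr => //; exact: LD.1.
have AD : (\int[P]_(w in A) `|(D w)%:E|)%E = 0%E.
  apply/eqP; rewrite eq_le integral_ge0 ?andbT; last by [].
  under eq_integral => w /[!inE] Aw do rewrite gee0_abs ?lee_fin ?(ltW Aw)//.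
  rewrite (_ : \int[P]_(w in A) (D w)%:E = Q' A - M%:E * Q A)%E.
    rewrite leeBlDr ?add0e; first exact: Q'Q.
    by rewrite fin_numM// fin_num_measure.
  case: dZ dZ' => [_ _ QE] [_ _ Q'E].
  rewrite (QE _ mA) (Q'E _ mA).
  rewrite -integralZl//; last exact: integrableS LZ.2.
  rewrite -integralB//.
  - exact: integrableS LZ'.2.
  - exact: integrableS (L1Z M LZ).2.
have /(ae_eq_integral_abs P mA) A0 : measurable_fun A (EFin \o D).
  exact/measurable_funTS/measurable_EFinP/LD.1.
move/A0: AD; apply: filterS => w Dw.
rewrite leNgt; apply/negP => MZ.
have Aw : A w by rewrite /A/= /D subr_gt0.
by have := Dw Aw; rewrite /= => -[] D0; move: Aw; rewrite /A/= D0 ltxx.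
Qed.

End density.

(** * Stability of [MhatV] under domination and midpoints *)

Section MhatV.
Context (R : realType) d (Omega : measurableType d) (P : probability Omega R).
Context (K : set (Omega -> R)) (a : \bar R) (U : R -> R).
Hypothesis uU : utility_assumptions a U.
Implicit Types Q : probability Omega R.

Definition loss_density (b : R) (Z : Omega -> R) (w : Omega) : \bar R :=
  if b <= Z w then Vplus a U (Z w) else 0%E.

Lemma loss_density_ge0 b Z w : (0 <= loss_density b Z w)%E.
Proof. by rewrite /loss_density; case: ifP => // _; exact: Vplus_ge0. Qed.

Lemma measurable_loss_density b Z : measurable_fun setT Z ->
  measurable_fun setT (loss_density b Z).
Proof.
move=> mZ; apply: measurable_fun_ifT.
- exact: measurable_fun_ler.
- by apply: measurableT_comp => //; exact: measurable_Vplus.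
- exact: measurable_cst.
Qed.

Lemma finite_loss_entropy_le Q Z b (G : Omega -> \bar R) :
  is_density P Q Z -> 0 < b -> measurable_fun setT G -> (forall w, 0 <= G w)%E ->
  (\int[P]_w G w < +oo)%E ->
  {ae P, forall w, b <= Z w -> (Vplus a U (Z w) <= G w)%E} ->
  finite_loss_entropy a U P Q.
Proof.
move=> dZ b0 mG G0 iG VG; exists Z; split => //; exists b => //.
apply: le_lt_trans iG; apply: ae_ge0_le_integral => //.
- by move=> w _; exact: loss_density_ge0.
- by apply: measurable_loss_density; case: dZ.
- move: VG; apply: filterS => w VG _ /=.
  by case: ifP => // /VG.
Qed.

Lemma finite_loss_entropy_scale Q Q' M : 0 <= M -> measure_le_scale M Q' Q ->
  Q `<< P -> finite_loss_entropy a U P Q -> finite_loss_entropy a U P Q'.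
Proof.
move=> M0 Q'Q QP [Z [dZ [b b0 iZ]]].
have Q'P : Q' `<< P.
  have := measure_le_scale_null Q'Q.
  by move/null_dominates_trans; apply.
have [Z' dZ'] := exists_density Q'P.
pose C := Num.max 1 M.
have C1 : 1 <= C by rewrite le_max lexx.
have [A [B [y0 [A0 B0 y00 VC]]]] := Vplus_scale uU C1.
(* The threshold for [Z'] is [C * b1]: since [Z' <= C Z] almost surely, passing it forces both
   [Z >= b] and [Z >= y0]. *)
pose b1 := Num.max b y0.
have b10 : 0 < b1 by rewrite lt_max b0.
have Cb0 : 0 < C * b1 by rewrite mulr_gt0//; lra.
have mZ : measurable_fun setT Z by case: dZ.
have Z0 w : 0 <= Z w by case: dZ.
have LZ := is_density_L1 dZ.
set v := fine (Vplus a U (C * b1)).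
have vE : Vplus a U (C * b1) = v%:E by rewrite fineK// Vplus_fin_num.
have v0 : 0 <= v by rewrite -lee_fin -vE Vplus_ge0.
(* Quasiconvexity on [C b1 <= Z' <= C Z] gives [V^+(Z') <= V^+(C b1) + V^+(C Z)], and the growth
   bound on the last term yields [G]. *)
pose G w : \bar R := ((v + B * Z w)%:E + A%:E * loss_density b Z w)%E.
have mvZ : measurable_fun setT (fun w => (v + B * Z w)%:E).
  by apply/measurable_EFinP; apply: measurable_funD => //; exact: measurable_funM.
have vZ0 w : (0 <= (v + B * Z w)%:E)%E by rewrite lee_fin addr_ge0// mulr_ge0.
have mL := measurable_loss_density b mZ.
have mAL : measurable_fun setT (fun w => A%:E * loss_density b Z w)%E.
  exact: emeasurable_funM.
have AL0 w : (0 <= A%:E * loss_density b Z w)%E.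
  by rewrite mule_ge0 ?loss_density_ge0.
apply: (@finite_loss_entropy_le Q' Z' (C * b1) G) => //.
- exact: emeasurable_funD.
- by move=> w; rewrite adde_ge0.
- rewrite ge0_integralD//; apply: lte_add_pinfty.
    have LvZ : L1 P (fun w => v + B * Z w).
      apply: L1D; last exact: L1Z.
      by apply: (@L1_bounded _ _ _ _ _ `|v|) => //; exact: measurable_cst.
    have := integrable_fin_num measurableT LvZ.2.
    by rewrite fin_numElt => /andP[].
  rewrite ge0_integralZl//; last by move=> w _; exact: loss_density_ge0.
  by rewrite lte_mul_pinfty.
- have := density_le_ae dZ dZ' Q'Q; apply: filterS => w Z'Z CbZ'.
  have Z'C : Z' w <= C * Z w.
    by rewrite (le_trans Z'Z)// ler_wpM2r// le_max lexx orbT.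
  have b1Z : b1 <= Z w.
    by rewrite -(ler_pM2l (lt_le_trans ltr01 C1)) (le_trans CbZ').
  have bZ : b <= Z w by rewrite (le_trans _ b1Z)// le_max lexx.
  have y0Z : y0 <= Z w by rewrite (le_trans _ b1Z)// le_max lexx orbT.
  apply: (le_trans (Vplus_leD _ _ CbZ' Z'C)); rewrite vE /G /loss_density bZ.
  rewrite EFinD -addeA leeD2l// addeC; exact: VC.
Qed.

Lemma MhatV_scale Q Q' M : MhatV a U P K Q -> 0 <= M ->
  measure_le_scale M Q' Q -> (forall X, K X -> \int[Q']_w X w <= 0) ->
  MhatV a U P K Q'.
Proof.
move=> [[QP QK] fQ] M0 Q'Q Q'K; split; last exact: (finite_loss_entropy_scale M0 Q'Q QP fQ).
split; first by have := measure_le_scale_null Q'Q; move/null_dominates_trans; apply.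
move=> X KX; have LX := measure_le_scale_L1 M0 Q'Q (QK X KX).1; split => //.
rewrite -[X in (X <= _)%E]fineK ?lee_fin; first exact: Q'K.
by apply: integrable_fin_num => //; exact: LX.2.
Qed.

Lemma MhatV_midpoint Q1 Q2 : MhatV a U P K Q1 -> MhatV a U P K Q2 ->
  exists Q, [/\ MhatV a U P K Q, measure_le_scale 2 Q1 Q & measure_le_scale 2 Q2 Q].
Proof.
move=> [[Q1P Q1K] [Z1 [dZ1 [b1 b10 iZ1]]]] [[Q2P Q2K] [Z2 [dZ2 [b2 b20 iZ2]]]].
have [Q [QE QX]] := exists_midpoint Q1 Q2.
exists Q; split; last 2 first.
- move=> A mA; suff : (Q1 A <= 2%:E * Q A)%E by [].
  by rewrite QE// muleA -EFinM mulfV// mul1e leeDl.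
- move=> A mA; suff : (Q2 A <= 2%:E * Q A)%E by [].
  by rewrite QE// muleA -EFinM mulfV// mul1e leeDr.
have Fin m X : L1 m X -> (\int[m]_w (X w)%:E = (\int[m]_w X w)%:E)%E.
  by move=> [mX iX]; rewrite fineK//; exact: integrable_fin_num.
split.
  split.
    apply/null_content_dominatesP => A mA PA; suff : Q A = 0%E by [].
    have Q1A : Q1 A = 0%E by move/null_content_dominatesP : Q1P; exact.
    have Q2A : Q2 A = 0%E by move/null_content_dominatesP : Q2P; exact.
    by rewrite QE// Q1A Q2A adde0 mule0.
  move=> X KX; have [LX1 i1] := Q1K X KX; have [LX2 i2] := Q2K X KX.
  have [LX iX] := QX X LX1 LX2; split => //.
  move: i1 i2; rewrite !Fin// iX !lee_fin; lra.
pose Z w := 2^-1 * (Z1 w + Z2 w).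
have [mZ1 Z10 Q1E] := dZ1; have [mZ2 Z20 Q2E] := dZ2.
have dZ : is_density P Q Z.
  split.
  - by apply: measurable_funM => //; exact: measurable_funD.
  - by move=> w; rewrite mulr_ge0 ?addr_ge0.
  - move=> A mA; rewrite (QE A mA : (Q : {measure set Omega -> \bar R}) A = _).
    rewrite (Q1E A mA : Q1 A = _) (Q2E A mA : Q2 A = _).
    have mZ1A : measurable_fun A (EFin \o Z1) by exact/measurable_funTS/measurable_EFinP.
    have mZ2A : measurable_fun A (EFin \o Z2) by exact/measurable_funTS/measurable_EFinP.
    rewrite -ge0_integralD//; [|by move=> *; rewrite lee_fin..].
    rewrite -ge0_integralZl//; first exact: emeasurable_funD.
    by move=> w _; rewrite adde_ge0 ?lee_fin.
(* The larger of [Z1] and [Z2] is at least [Z], so above this common threshold it also passes its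
   own. Quasiconvexity between [b] and that larger value bounds the loss by [G]. *)
pose b := Num.max b1 b2.
have b0 : 0 < b by rewrite lt_max b10.
have vE : Vplus a U b = (fine (Vplus a U b))%:E by rewrite fineK// Vplus_fin_num.
pose G w : \bar R := (Vplus a U b + (loss_density b1 Z1 w + loss_density b2 Z2 w))%E.
have mL1 := measurable_loss_density b1 mZ1.
have mL2 := measurable_loss_density b2 mZ2.
have L1_ge0 := @loss_density_ge0 b1 Z1.
have L2_ge0 := @loss_density_ge0 b2 Z2.
apply: (@finite_loss_entropy_le Q Z b G) => //.
- by apply: emeasurable_funD => //; exact: emeasurable_funD.
- by move=> w; rewrite !adde_ge0 ?Vplus_ge0.
- rewrite ge0_integralD//; [|by move=> *; exact: Vplus_ge0|by move=> w _; rewrite adde_ge0|exact: emeasurable_funD].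
  rewrite ge0_integralD//; apply: lte_add_pinfty; last exact: lte_add_pinfty.
  rewrite vE integral_cst//; apply: lte_mul_pinfty => //.
    by rewrite -vE Vplus_ge0.
  by apply: (le_lt_trans (probability_le1 P measurableT)); rewrite ltry.
- apply: aeW => w bZ; rewrite /G.
  have [Z12|Z21] := leP (Z1 w) (Z2 w).
  + have ZZ2 : Z w <= Z2 w by rewrite /Z; lra.
    apply: (le_trans (Vplus_leD _ _ bZ ZZ2)); rewrite leeD2l//.
    have b2Z : b2 <= Z2 w.
      by rewrite (le_trans _ ZZ2)// (le_trans _ bZ)// le_max lexx orbT.
    by rewrite [loss_density b2 _ _]/loss_density b2Z leeDr.
  + have ZZ1 : Z w <= Z1 w by rewrite /Z; lra.
    apply: (le_trans (Vplus_leD _ _ bZ ZZ1)); rewrite leeD2l//.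
    have b1Z : b1 <= Z1 w.
      by rewrite (le_trans _ ZZ1)// (le_trans _ bZ)// le_max lexx.
    by rewrite [loss_density b1 _ _]/loss_density b1Z leeDl.
Qed.

(** Induction by successive midpoints; [Q0] starts it and serves the empty family. *)
Lemma MhatV_directed n (Q : 'I_n -> probability Omega R) :
  (exists Q0, MhatV a U P K Q0) -> (forall i, MhatV a U P K (Q i)) ->
  exists Q', MhatV a U P K Q' /\
    exists2 M, 0 <= M & forall i, measure_le_scale M (Q i) Q'.
Proof.
move=> [Q0 hQ0] hQ.
suff /(_ n (leqnn n))[Q' [hQ' [M M0 QQ']]] : forall k, (k <= n)%N ->
    exists Q', MhatV a U P K Q' /\
    exists2 M, 0 <= M & forall i : 'I_n, (i < k)%N -> measure_le_scale M (Q i) Q'.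
  by exists Q'; split => //; exists M => // i; exact: QQ'.
elim=> [_|k IH kn]; first by exists Q0; split => //; exists 0.
have [Q' [hQ' [M M0 QQ']]] := IH (ltnW kn).
have [Q'' [hQ'' d1 d2]] := MhatV_midpoint hQ' (hQ (Ordinal kn)).
(* The earlier measures pay a factor 2 for passing from [Q'] to [Q''], the new one costs 2; the sum
   covers both. *)
exists Q''; split => //; exists (M * 2 + 2) => [|i]; first by lra.
rewrite ltnS leq_eqVlt => /orP[/eqP ik|ik].
- have -> : i = Ordinal kn by exact: val_inj.
  by apply: measure_le_scale_le d2; lra.
- apply: (@measure_le_scale_le _ _ _ (M * 2)); first lra.
  exact: measure_le_scale_trans (QQ' i ik) d1.
Qed.

End MhatV.

(** * Bounded truncation in L1(Q) *)

Section truncation.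
Context (R : realType) d (Omega : measurableType d).

Lemma null_dominates_ae (mu nu : {measure set Omega -> \bar R}) (S : Omega -> Prop) :
  nu `<< mu -> {ae mu, forall w, S w} -> {ae nu, forall w, S w}.
Proof.
by move=> /null_content_dominatesP numu [A [mA A0 SA]]; exists A; split => //; exact: numu.
Qed.

(** A bounded [W] is integrable under every probability, whereas [Y] is only known to be so under
    [Q]; subtracting [W] therefore stays inside [LU]. The truncations converge by dominated
    convergence. *)
Lemma L1_truncation (Q : probability Omega R) (Y : Omega -> R) (eps : R) :
  L1 Q Y -> {ae Q, forall w, 0 <= Y w} -> 0 < eps ->
  exists W : Omega -> R, [/\ measurable_fun setT W,
    exists M, forall w, 0 <= W w <= M &
    L1norm Q (fun w => Y w - W w) < eps].
Proof.
move=> LY Y0 eps0.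
pose W n w : R := Num.min (Num.max (Y w) 0) n%:R.
have mY : measurable_fun setT Y := LY.1.
have mW n : measurable_fun setT (W n).
  by apply: measurable_minr => //; exact: measurable_maxr.
have W0 n w : 0 <= W n w by rewrite le_min le_max lexx orbT/=.
have Wn n w : W n w <= n%:R by rewrite ge_min lexx orbT.
have mWE n : measurable_fun setT (fun w => (W n w)%:E) by exact/measurable_EFinP.
have mYE : measurable_fun setT (EFin \o Y) by exact/measurable_EFinP.
have WY : {ae Q, forall w, [set: Omega] w -> (W n w)%:E @[n --> \oo] --> (Y w)%:E}.
  move: Y0; apply: filterS => w Yw _; apply: cvg_near_cst.
  have := nbhs_infty_ger (Y w); apply: filterS => n Yn.
  by congr EFin; rewrite /W (max_idPl Yw); apply/min_idPl.
have WleY : {ae Q, forall w n, [set: Omega] w -> (`|(W n w)%:E| <= `|Y w|%:E)%E}.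
  apply: aeW => w n _; rewrite lee_fin ger0_norm// ge_min ge_max ler_norm.
  by rewrite normr_ge0.
have [_ + _] :=
  dominated_convergence measurableT mWE mYE WY (L1_abs LY).2 WleY.
move=> /fine_cvgP[_ /cvgrPdist_lt /(_ _ eps0) [n _ /(_ n (leqnn n)) /=]]; rewrite sub0r normrN => Weps.
exists (W n); split => //.
  by exists n%:R => w; rewrite W0 Wn.
rewrite (le_lt_trans _ Weps)// (le_trans _ (ler_norm _))// /L1norm /Rintegral.
by under eq_integral do rewrite distrC.
Qed.

End truncation.

(** * Comparison of the three closures *)

Section main.
Context (R : realType) d (Omega : measurableType d) (P : probability Omega R).
Context (K : set (Omega -> R)) (a : \bar R) (U : R -> R).
Hypothesis cK : convex_cone K.
Hypothesis uU : utility_assumptions a U.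
Implicit Types (Q : probability Omega R) (X Y W Z : Omega -> R).

Local Notation MhatV := (MhatV a U P K).
Local Notation LU := (LU a U P K).
Local Notation KU := (KU a U P K).

Lemma LU_linear_subspace : linear_subspace LU.
Proof.
split.
  by split; [exact: measurable_cst|move=> Q _; exact: (L1_linear_subspace Q).1].
move=> t X Y [mX LX] [mY LY]; split.
  by apply: measurable_funD => //; exact: measurable_funM.
by move=> Q hQ; apply: (L1_linear_subspace Q).2; [exact: LX|exact: LY].
Qed.

Lemma LU_bounded X M : measurable_fun setT X -> (forall w, `|X w| <= M) -> LU X.
Proof. by move=> mX XM; split => // Q _; exact: L1_bounded XM. Qed.

Lemma sub_LU X : K X -> LU X.
Proof.
move=> KX; split; first exact: cK.1.
by move=> Q [[_ QK] _]; exact: (QK X KX).1.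
Qed.

(** [convex_cone] admits the empty set, so nonemptiness is derived separately wherever 0 is used. *)
Lemma convex_cone0 : K !=set0 -> K (fun=> 0).
Proof.
move=> [X KX]; have := cK.2 X X 0 0 KX KX (lexx _) (lexx _).
by under eq_fun do rewrite !mul0r addr0.
Qed.

Lemma KU_add Y Y' : KU Y -> KU Y' -> KU (Y + Y').
Proof.
move=> [LY [X KX YX]] [LY' [X' KX' YX']]; split.
  by apply: subspaceD => //; exact: LU_linear_subspace.
exists (fun w => 1 * X w + 1 * X' w); first exact: cK.2.
move: YX YX'; apply: filterS2 => w YX YX'.
by rewrite !mul1r lerD.
Qed.

Lemma KU_scale t Y : 0 <= t -> KU Y -> KU (t *: Y).
Proof.
move=> t0 [LY [X KX YX]]; split.
  by apply: subspaceZ => //; exact: LU_linear_subspace.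
exists (fun w => t * X w + 0 * X w); first exact: cK.2.
by move: YX; apply: filterS => w YX; rewrite mul0r addr0 ler_wpM2l.
Qed.

Lemma KU_bounded_below X W M : K X -> measurable_fun setT W ->
  (forall w, 0 <= W w <= M) -> KU (fun w => X w - W w).
Proof.
move=> KX mW WM; split.
  apply: (subspaceD LU_linear_subspace (sub_LU KX)).
  apply: (subspaceN LU_linear_subspace); apply: (@LU_bounded _ M) => // w.
  by have /andP[W0 ?] := WM w; rewrite ger0_norm.
exists X => //; apply: aeW => w; have /andP[W0 _] := WM w.
by rewrite lerBlDr lerDl.
Qed.

Lemma KU0 : K !=set0 -> KU 0.
Proof.
move=> /convex_cone0 K0; split; first exact: LU_linear_subspace.1.
by exists (fun=> 0) => //; apply: aeW.
Qed.

Lemma KU_indic A : K !=set0 -> measurable A -> KU (- \1_A).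
Proof.
move=> /convex_cone0 K0 mA.
have -> : - \1_A = (fun w => 0 - \1_A w) :> (Omega -> R).
  by apply/funext => w; rewrite sub0r.
apply: (@KU_bounded_below _ _ 1) => //.
by move=> w; rewrite indicE; case: (_ \in _); rewrite ?lexx ?ler01.
Qed.

Lemma LVplus_density Q Z : MhatV Q -> is_density P Q Z ->
  LVplus a U P K (fun w => \sum_(i < 1) 1 * Z w).
Proof.
by move=> hQ dZ; exists 1%N, (fun=> 1), (fun=> Q), (fun=> Z); split.
Qed.

Lemma CU_sub_L1_closure X Q : CU a U P K X -> MhatV Q -> L1_closure Q KU X.
Proof.
move=> [LX clX] hQ; apply: contrapT => nX.
(* The neighbourhood given by no functional at all still meets [KU], which provides an element of
   [K]. *)
have K0 : K !=set0.
  have [|Y [[_ [Y' KY' _]] _] _] := clX 0%N (fun=> 0) 1 _ ltr01; last by exists Y'.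
  by case.
have [|||||||Q' [M [M0 Q'Q Q'KU Q'X]]] := @separating_probability _ _ _ Q KU X.
- by move=> Y [[_ LY] _]; exact: LY.
- exact: KU0.
- exact: KU_add.
- exact: KU_scale.
- by move=> A; exact: KU_indic.
- exact: LX.2.
- by [].
have hQ' : MhatV Q'.
  apply: (MhatV_scale uU hQ M0 Q'Q) => Y KY; apply: Q'KU.
  split; first exact: sub_LU.
  by exists Y => //; apply: aeW.
have [Z' dZ'] := exists_density hQ'.1.1.
(* The radius is the integral of [X] under [Q']: a [Y] this close to [X] has positive integral,
   against [Q'KU]. *)
have [Y [KUY LY] /(_ ord0)] :=
  clX 1%N _ _ (fun=> LVplus_density hQ' dZ') Q'X.
have LXY : L1 Q' (fun w => Y w - X w) by apply: L1B; [exact: LY.2|exact: LX.2].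
rewrite /pairing; under eq_integral do rewrite big_ord1 mul1r.
rewrite -/(Rintegral P setT _) (is_density_change dZ' LXY).2.
rewrite RintegralB//; [|exact: (LY.2 _ hQ').2|exact: (LX.2 _ hQ').2].
have := Q'KU _ KUY; rewrite ltr_norml => ? /andP[+ _]; lra.
Qed.

(** The finitely many measures behind [f] are dominated by a single one in [MhatV]. Measure and
    constant form a pair so that [choice] selects both at once. *)
Lemma LVplus_bounded f : (exists Q0, MhatV Q0) -> LVplus a U P K f ->
  exists QM : probability Omega R * R, [/\ MhatV QM.1, 0 <= QM.2 &
    forall Y, LU Y -> `|pairing P Y f| <= QM.2 * L1norm QM.1 Y].
Proof.
move=> hQ0 [n [c [Q [Z [hQZ ->]]]]].
have [Q' [hQ' [M M0 QQ']]] := MhatV_directed uU hQ0 (fun i => (hQZ i).1).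
exists (Q', \sum_(i < n) `|c i| * M); split => //=.
  by apply: sumr_ge0 => i _; rewrite mulr_ge0.
move=> Y LY.
have chg i := is_density_change (hQZ i).2 (LY.2 _ (hQZ i).1).
have -> : pairing P Y (fun w => \sum_(i < n) c i * Z i w) =
    \sum_(i < n) c i * \int[Q i]_w Y w.
  have [_] := L1_linear_sum (index_enum 'I_n) c (@Rintegral_linear _ _ _ P) (fun i => (chg i).1).
  under [X in _ = X -> _]eq_bigr => i _ do rewrite (chg i).2.
  move=> <-; rewrite /pairing -/(Rintegral P setT _); apply: eq_Rintegral => w _.
  rewrite fct_sumE mulr_sumr; apply: eq_bigr => i _; rewrite mulrCA//.
rewrite (le_trans (ler_norm_sum _ _ _))// mulr_suml ler_sum// => i _.
rewrite normrM -mulrA ler_wpM2l//.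
rewrite (le_trans (normr_Rintegral_L1norm (LY.2 _ (hQZ i).1)))//.
by apply: measure_le_scale_L1norm => //; exact: LY.2.
Qed.

Lemma L1_closure_sub_CU X : L0 X -> (forall Q, MhatV Q -> L1_closure Q KU X) ->
  CU a U P K X.
Proof.
move=> mX clX.
have LX : LU X by split => // Q /clX[].
split => // n f eps hf eps0.
have [hQ0|nQ] := pselect (exists Q0, MhatV Q0); last first.
  (* Were [K] empty, [P] itself would lie in [MhatV]: its constraints are vacuous, and its density 1
     stays below the threshold 2. *)
  have K0 : K !=set0.
    apply: contrapT => nK; apply: nQ; exists P; split.
      by split => // Y KY; exfalso; apply: nK; exists Y.
    exists (cst 1); split.
      split; [exact: measurable_cst|by []|move=> A mA].
      by rewrite -[RHS]/(\int[P]_(w in A) cst 1 w)%E integral_cst// mul1e.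
    by exists 2 => //; rewrite integral0_eq// => w _; rewrite lt_geF// ltr1n.
  (* With [MhatV] empty, every element of the span is an empty sum, so all pairings vanish and 0
     lies in the neighbourhood. *)
  exists 0; first by split; [exact: KU0|exact: LU_linear_subspace.1].
  move=> i; have [m [c [Q [Z [hQ ->]]]]] := hf i.
  case: m c Q Z hQ => [|m] c Q Z hQ; last by exfalso; apply: nQ; exists (Q ord0); exact: (hQ ord0).1.
  rewrite /pairing integral0_eq ?normr0// => w _.
  by rewrite big_ord0 mulr0.
have /choice[g hg] := fun i => LVplus_bounded hQ0 (hf i).
have [|Q' [hQ' [M M0 gQ']]] := MhatV_directed uU hQ0 (fun i => _ : MhatV (g i).1).
  by move=> i; case: (hg i).
(* [S] bounds all the constants [(g i).2], and the 1 in [S * M + 1] makes the divisor of [eps]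
   positive. *)
pose S := \sum_(i < n) (g i).2.
have g0 i : 0 <= (g i).2 by case: (hg i).
have S0 : 0 <= S by exact: sumr_ge0.
have D0 : 0 < S * M + 1 by rewrite ltr_wpDl// mulr_ge0.
have [_ /(_ _ (divr_gt0 eps0 D0))[Y [KUY LQY]]] := clX _ hQ'.
have LYX : LU (fun w => Y w - X w).
  apply: (subspaceD LU_linear_subspace KUY.1).
  exact: (subspaceN LU_linear_subspace).
rewrite L1normE; last by apply: L1B => //; exact: LX.2.
rewrite lte_fin ltr_pdivlMr// => XY.
exists Y; first by split => //; exact: KUY.1.
move=> i; have [hgi gi0 gb] := hg i.
rewrite (le_lt_trans (gb _ LYX))// (le_lt_trans _ XY)//.
have -> : L1norm Q' (fun w => X w - Y w) = L1norm Q' (fun w => Y w - X w).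
  by apply: eq_Rintegral => w _; rewrite distrC.
have qp := measure_le_scale_L1norm M0 (gQ' i) (LYX.2 _ hQ').
have p0 := L1norm_ge0 Q' (fun w => Y w - X w).
have giS : (g i).2 <= S by rewrite /S (bigD1 i)//= lerDl sumr_ge0.
have := ler_pM gi0 (L1norm_ge0 _ _) giS qp.
by lra.
Qed.

(** An element [Y] of [KU] below [X'] equals [X' - (X' - Y)], already of the second form. Conversely
    the subtracted function is truncated; approximation and truncation each use [eps / 2]. *)
Lemma L1_closure_KU_minus Q X : MhatV Q ->
  L1_closure Q KU X <-> L1_closure Q (K_minus_L1plus K Q) X.
Proof.
move=> hQ; split=> -[LX clX]; split => // eps eps0.
  have [Y [[LUY [X' KX' YX']] LY] XY] := clX _ eps0.
  exists Y => //; split => //; exists X', (fun w => X' w - Y w); split => //.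
  - by apply: L1B => //; exact: (hQ.1.2 _ KX').1.
  - have := null_dominates_ae hQ.1.1 YX'.
    by apply: filterS => w; rewrite subr_ge0.
  - by apply/funext => w; rewrite opprB addrC subrK.
have e20 : 0 < eps / 2 by lra.
have [_ [[X' [Y [KX' LY Y0 ->]]] LXY XY]] := clX _ e20.
have [W [mW [M WM] YW]] := L1_truncation LY Y0 e20.
have KUW := KU_bounded_below KX' mW WM.
have LW : L1 Q (fun w => X' w - W w) by exact: KUW.1.2.
have LX' : L1 Q X' := (hQ.1.2 _ KX').1.
have LWQ : L1 Q W.
  by apply: (@L1_bounded _ _ _ _ _ M) => // w; have /andP[W0 ?] := WM w; rewrite ger0_norm.
exists (fun w => X' w - W w) => //.
rewrite L1normE ?lte_fin; last exact: L1B.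
move: XY; rewrite L1normE ?lte_fin; last exact: L1B.
move=> XY.
have -> : (fun w => X w - (X' w - W w)) =
    (fun w => X w - (X' w - Y w)) - (fun w => Y w - W w).
  by apply/funext => w; rewrite !fctE; ring.
rewrite (le_lt_trans (ler_L1normD _ _))//; first exact: L1B.
  by apply: (subspaceN (L1_linear_subspace Q)); exact: L1B.
by rewrite L1normN; lra.
Qed.

End main.

Unset Implicit Arguments.

Theorem theorem6p1 (R : realType) (d : measure_display) (Omega : measurableType d)
    (P : probability Omega R) (K : set (Omega -> R))
    (a : \bar R) (U : R -> R) :
  convex_cone K ->
  utility_assumptions a U ->
  CU a U P K =
    bigcap_MhatV a U P K (fun Q => L1_closure Q (KU a U P K)) /\
  bigcap_MhatV a U P K (fun Q => L1_closure Q (KU a U P K)) =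
    bigcap_MhatV a U P K (fun Q => L1_closure Q (K_minus_L1plus K Q)).
Proof.
move=> cK uU; split; apply/seteqP; split=> X.
- move=> CX; split; first exact: CX.1.1.
  by move=> Q; exact: (CU_sub_L1_closure cK uU).
- by move=> [mX]; exact: (L1_closure_sub_CU cK uU).
- move=> [mX clX]; split => // Q hQ.
  exact: (L1_closure_KU_minus cK X hQ).1 (clX Q hQ).
- move=> [mX clX]; split => // Q hQ.
  exact: (L1_closure_KU_minus cK X hQ).2 (clX Q hQ).
Qed.
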